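(* Let $I,J$ be nonempty finite sets and let $A=[a_{ij}]$ and $H$ be real matrices indexed by $I\times J$. The differential game $\mathcal G(0,0)$ (with data $A,H$, starting at time $0$ with initial state $0$) has a value $W(0,0)$, i.e. $W^-(0,0)=W^+(0,0)=:W(0,0)$, and $$W(0,0)=\lim_{q\to0}W(0,q),$$ where $q\to0$ in $\mathbb R_+^{I\times J}\setminus\{0\}$ and $W(0,q)$ is the value of the differential game $\mathcal G(0,q)$.
   Context: Notation. $|\cdot|$ is the $\ell^1$-norm and $\langle\cdot,\cdot\rangle$ the canonical inner product on $\mathbb R^{I\times J}$; $\Delta(I),\Delta(J)$ are the sets of probability distributions on $I$ and $J$; $(u\otimes v)_{ij}=u_iv_j$. Define $h:\mathbb R_+^{I\times J}\to\mathbb R$ by $h(q)=\langle H,q/|q|\rangle$ if $q\neq0$ and $h(0)=0$. The differential game $\mathcal G(t,q)$, for $t\in[0,1]$ and $q\in\mathbb R_+^{I\times J}$: let $\mathcal U_t$ (resp. $\mathcal V_t$) be the set of measurable controls $\tilde u:[t,1]\to\Delta(I)$ (resp. $\tilde v:[t,1]\to\Delta(J)$). Given $(\tilde u,\tilde v)$, the state follows $\frac{dq}{ds}(s)=\tilde u(s)\otimes\tilde v(s)$ on $(t,1)$, $q(t)=q$, and the payoff to Player 1 (maximizer), paid by Player 2, is $$G(t,q,\tilde u,\tilde v)=\int_t^1\big(h(q(s))+\langle\tilde u(s)\otimes\tilde v(s),A\rangle\big)ds.$$ A non-anticipative strategy of Player 1 is a map $\alpha:\mathcal V_t\to\mathcal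 U_t$ such that for every $\tilde t>t$, if $\tilde v_1=\tilde v_2$ on $[t,\tilde t]$ then $\alpha[\tilde v_1]=\alpha[\tilde v_2]$ on $[t,\tilde t]$; non-anticipative strategies $\beta:\mathcal U_t\to\mathcal V_t$ of Player 2 are defined analogously. Their sets are $\mathcal A_t,\mathcal B_t$. The lower and upper values are $$W^-(t,q)=\sup_{\alpha\in\mathcal A_t}\inf_{\tilde v\in\mathcal V_t}G(t,q,\alpha[\tilde v],\tilde v),\qquad W^+(t,q)=\inf_{\beta\in\mathcal B_t}\sup_{\tilde u\in\mathcal U_t}G(t,q,\tilde u,\beta[\tilde u]).$$ When they coincide, $\mathcal G(t,q)$ is said to have a value, denoted $W(t,q)$. It is known (Evans–Souganidis, Souganidis) that for every $t\in[0,1)$ and $q\in\mathbb R_+^{I\times J}\setminus\{0\}$ the game $\mathcal G(t,q)$ has a value $W(t,q)$. *)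

(* Defs.v *)
From HB Require Import structures.
From mathcomp Require Import all_boot all_order all_algebra.
From mathcomp Require Import all_classical all_reals all_analysis.
Import Order.TTheory GRing.Theory Num.Theory.
Import numFieldNormedType.Exports.
(* R^(I x J) is the function type [I * J -> R]; ArrowAsProduct gives it the
   product topology, i.e. the usual one since I and J are finite. *)
Export ArrowAsProduct.
Set Implicit Arguments.
Unset Strict Implicit.
Unset Printing Implicit Defensive.
Local Open Scope classical_set_scope.
Local Open Scope ring_scope.

Definition simplex (R : realType) (K : finType) : set (K -> R) :=
  [set p | (forall k, 0 <= p k) /\ \sum_k p k = 1].

Definition orthant (R : realType) (K : finType) : set (K -> R) :=
  [set q | forall k, 0 <= q k].

Definition inner (R : realType) (K : finType) (x y : K -> R) : R :=
  \sum_k x k * y k.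

Definition l1norm (R : realType) (K : finType) (x : K -> R) : R :=
  \sum_k `|x k|.

Definition tensor (R : realType) (I J : finType) (u : I -> R) (v : J -> R) :
  I * J -> R := fun ij => u ij.1 * v ij.2.

(* Measurability is the Borel one carried by R.  A control on [t, 1] is
   represented by a function on R of which only the restriction to [t, 1]
   matters: the payoff ignores the other values and, for t < 1, so does a
   non-anticipative strategy (take t' = 1 in [nonanticipative]). *)
Definition controls (R : realType) (K : finType) (t : R) : set (R -> K -> R) :=
  [set u | (forall k, measurable_fun `[t, 1] (fun s => u s k)) /\
           forall s, s \in `[t, 1] -> simplex (u s)].

Definition nonanticipative (R : realType) (K L : finType) (t : R) :
  set ((R -> L -> R) -> (R -> K -> R)) :=
  [set a | set_fun (controls t) (controls t) a /\
    forall v1 v2, controls t v1 -> controls t v2 ->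
    forall t', t' \in `]t, 1] ->
      {in `[t, t'], v1 =1 v2} -> {in `[t, t'], a v1 =1 a v2}].

Section game.
Context {R : realType} {I J : finType}.
Variables A H : I * J -> R.
Implicit Types (t : R) (q : I * J -> R).
Implicit Types (u : R -> I -> R) (v : R -> J -> R).

Definition hpay q : R := if q == 0 then 0 else inner H ((l1norm q)^-1 *: q).

(* For measurable controls, dq/ds = u(s) (x) v(s) with q(t) = q is understood
   in the Caratheodory sense; the right-hand side does not involve the state,
   so the solution is this primitive. *)
Definition state t q u v (s : R) : I * J -> R := fun ij =>
  q ij + \int[lebesgue_measure]_(r in `[t, s]) tensor (u r) (v r) ij.

Definition payoff t q u v : R :=
  \int[lebesgue_measure]_(s in `[t, 1])
    (hpay (state t q u v s) + inner (tensor (u s) (v s)) A).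

Definition lower_value t q : \bar R :=
  ereal_sup [set ereal_inf [set (payoff t q (alpha v) v)%:E | v in controls t]
            | alpha in @nonanticipative R I J t].

Definition upper_value t q : \bar R :=
  ereal_inf [set ereal_sup [set (payoff t q u (beta u))%:E | u in controls t]
            | beta in @nonanticipative R J I t].

Definition is_value t q (w : R) : Prop :=
  lower_value t q = w%:E /\ upper_value t q = w%:E.

End game.

(* Main.v *)
(* Since [|q(s)| = |q| + s], replacing [|q|] by [max (|q|, e)] in [h] turns the running payoff into
   a Lipschitz function of the state and changes every payoff by [O(e)] only, uniformly in the
   initial state and the controls; this gives the convergence of the values as [q -> 0] at once.
   For a Lipschitz running payoff, compare with the game on a grid of step [1/N] in which player 2
   moves first, and let [c] be any level.  If player 2 can prevent [c] there, he does so in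
   continuous time with a strategy that is constant on each step and only uses the past.  If
   player 1 can secure [c], he follows a fictitious path on which he answers player 2, and keeps it
   close to the real one by extremal aiming (Krasovskii-Subbotin): on each step he plays an
   approximate saddle point of the bilinear form given by the gap between both paths, so that its
   square grows by [O(1/N^2)].  A strategy with such a delay can be played against any
   nonanticipative strategy, hence bounds both the lower and the upper value: no level strictly
   separates them. *)
Require Import Defs.
From HB Require Import structures.
From mathcomp Require Import all_boot all_order all_algebra.
From mathcomp Require Import all_classical all_reals all_analysis.
From mathcomp Require Import measurable_realfun ring lra.
Set Implicit Arguments.
Unset Strict Implicit.
Unset Printing Implicit Defensive.
Import Order.TTheory GRing.Theory Num.Theory.
Import numFieldNormedType.Exports.
Import ArrowAsProduct.
Local Open Scope classical_set_scope.
Local Open Scope ring_scope.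

(** * Integrals of bounded functions over closed and half-open intervals *)

Section interval_integrals.
Context {R : realType}.
Notation mu := (@lebesgue_measure R).
Implicit Types (a b B : R) (f g : R -> R).

Lemma bounded_itv_integrable a b B f : measurable_fun `[a, b] f ->
  {in `[a, b], forall s, `|f s| <= B} -> mu.-integrable `[a, b] (EFin \o f).
Proof.
move=> mf fB; apply: measurable_bounded_integrable => //.
  rewrite /= lebesgue_measure_itv/=; case: ifP => _; last exact: ltry.
  by rewrite -EFinB ltry.
exists B; split; first exact: num_real.
by move=> c Bc s sab; apply: (le_trans (fB s sab)); exact: ltW.
Qed.

Lemma Rintegral_sum (K : finType) (D : set R) (F : K -> R -> R) :
  measurable D -> (forall k, mu.-integrable D (EFin \o F k)) ->
  \int[mu]_(s in D) (\sum_k F k s) = \sum_k \int[mu]_(s in D) F k s.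
Proof.
move=> mD iF; rewrite /index_enum; elim: (Finite.enum K) => [|k r IH].
  rewrite big_nil -[RHS](mul0r (fine (mu D))) -(@Rintegral_cst _ _ _ mu D mD).
  by apply: eq_Rintegral => s _; rewrite big_nil.
rewrite big_cons -IH -RintegralD//.
  by apply: eq_Rintegral => s _; rewrite big_cons.
rewrite (_ : _ \o _ = fun s => (\sum_(i <- r) (EFin \o F i) s)%E); last first.
  by apply/funext => s /=; rewrite sumEFin.
exact: integrable_sum.
Qed.

Lemma Rintegral_itv_split a b c f : a <= b -> b <= c ->
  mu.-integrable `[a, c[ (EFin \o f) ->
  \int[mu]_(s in `[a, c[) f s =
    \int[mu]_(s in `[a, b[) f s + \int[mu]_(s in `[b, c[) f s.
Proof.
move=> ab bc fi.
have E : `[a, c[%classic = `[a, b[%classic `|` `[b, c[%classic.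
  by rewrite -itv_bndbnd_setU// bnd_simp.
rewrite E Rintegral_setU//; first by rewrite -E.
apply/disj_setPS => y [/=]; rewrite !in_itv/= => /andP[_ yb] /andP[].
by rewrite leNgt yb.
Qed.

Lemma Rintegral_co_cst a b B : a <= b ->
  \int[mu]_(s in `[a, b[) B = B * (b - a).
Proof.
move=> ab; rewrite Rintegral_cst//= lebesgue_measure_itv/= lte_fin.
move: ab; rewrite le_eqVlt => /predU1P[->|->]//=.
by rewrite ltxx subrr.
Qed.

Lemma integrable_co_cst a b B : mu.-integrable `[a, b[ (EFin \o cst B).
Proof.
apply: (@integrableS _ _ _ mu `[a, b]) => //.
  by apply: subset_itvl; rewrite bnd_simp.
exact: (@bounded_itv_integrable _ _ `|B|).
Qed.

Lemma Rintegral_co_bound a b B f : a <= b ->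
  mu.-integrable `[a, b[ (EFin \o f) ->
  {in `[a, b[, forall s, `|f s| <= B} ->
  `|\int[mu]_(s in `[a, b[) f s| <= B * (b - a).
Proof.
move=> ab fi fB; apply: le_trans (le_normr_Rintegral _ fi) _ => //.
rewrite -Rintegral_co_cst//; apply: le_Rintegral => //.
- exact: integrable_norm.
- exact: integrable_co_cst.
Qed.

Lemma lipschitz_measurable_itv a b B f :
  {in `[a, b] &, forall r s, `|f r - f s| <= B * `|r - s|} ->
  measurable_fun `[a, b] f.
Proof.
move=> fL; apply: subspace_continuous_measurable_fun => //.
apply/subspace_continuousP => x xab; apply/cvgrPdist_lt => e e0.
(* [B] carries no sign hypothesis, so the modulus of continuity is taken with the positive constant
   [|B| + 1]. *)
have B0 : 0 < `|B| + 1 by rewrite ltr_pwDr.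
have d0 : 0 < e / (`|B| + 1) by rewrite divr_gt0.
have : \forall y \near x, `|x - y| < e / (`|B| + 1).
  exact: nbhsx_ballx.
rewrite near_withinE; apply: filterS => y xy yab.
apply: (@le_lt_trans _ _ ((`|B| + 1) * `|x - y|)).
  apply: le_trans (fL x y _ _) _; rewrite ?inE//.
  by rewrite ler_wpM2r// (le_trans (ler_norm B))// lerDl.
by rewrite mulrC -ltr_pdivlMr.
Qed.
End interval_integrals.

(** * Probability vectors, the l1-norm and the inner product *)

Section simplices.
Context {R : realType}.

Lemma simplex_le1 (K : finType) (p : K -> R) k : simplex p -> p k <= 1.
Proof.
by move=> [p0 <-]; rewrite (bigD1 k)//= lerDl; apply: sumr_ge0.
Qed.

Lemma simplex_norm_le1 (K : finType) (p : K -> R) k : simplex p -> `|p k| <= 1.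
Proof. by move=> hp; rewrite ger0_norm ?simplex_le1//; case: hp. Qed.

Lemma tensor_simplex (I J : finType) (p : I -> R) (r : J -> R) :
  simplex p -> simplex r -> simplex (tensor p r).
Proof.
move=> [p0 p1] [r0 r1]; split; first by move=> k; exact: mulr_ge0.
rewrite -(pair_bigA _ (fun i j => p i * r j))/= -[RHS]p1.
by apply: eq_bigr => i _; rewrite -mulr_sumr r1 mulr1.
Qed.

Lemma simplex_nonempty (K : finType) : (0 < #|K|)%N -> exists p : K -> R, simplex p.
Proof.
move=> /card_gt0P[k0 _]; exists (fun k => (k == k0)%:R); split=> [k|]; first exact: ler0n.
by rewrite (bigD1 k0)//= eqxx big1 ?addr0// => k /negPf ->.
Qed.

Lemma l1norm_ge0 (K : finType) (x : K -> R) : 0 <= l1norm x.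
Proof. by apply: sumr_ge0 => k _. Qed.

Lemma l1normD (K : finType) (x y : K -> R) : l1norm (x + y) <= l1norm x + l1norm y.
Proof.
by rewrite /l1norm -big_split/=; apply: ler_sum => k _; exact: ler_normD.
Qed.

Lemma l1normN (K : finType) (x : K -> R) : l1norm (- x) = l1norm x.
Proof. by apply: eq_bigr => k _; exact: normrN. Qed.

Lemma l1norm_orthant (K : finType) (x : K -> R) : orthant x -> l1norm x = \sum_k x k.
Proof. by move=> x0; apply: eq_bigr => k _; rewrite ger0_norm. Qed.

Lemma l1norm0_eq0 (K : finType) (x : K -> R) : l1norm x = 0 -> x = 0.
Proof.
move=> /eqP; rewrite psumr_eq0// => /allP x0; apply/funext => k.
by apply/eqP; rewrite -normr_eq0; apply: x0; rewrite mem_index_enum.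
Qed.

Lemma ler_l1norm (K : finType) (x : K -> R) k : `|x k| <= l1norm x.
Proof. by rewrite /l1norm (bigD1 k)//= lerDl sumr_ge0. Qed.

Lemma inner_le_l1norm (K : finType) (x y : K -> R) :
  `|inner x y| <= l1norm x * l1norm y.
Proof.
apply: le_trans (ler_norm_sum _ _ _) _.
rewrite /l1norm mulr_suml; apply: ler_sum => k _.
by rewrite normrM ler_wpM2l// ler_l1norm.
Qed.

Lemma innerBl (K : finType) (x y z : K -> R) : inner (x - y) z = inner x z - inner y z.
Proof. by rewrite /inner -sumrB; apply: eq_bigr => k _; rewrite -mulrBl. Qed.

Lemma simplex_l1norm (K : finType) (p : K -> R) : simplex p -> l1norm p = 1.
Proof. by move=> [p0 p1]; rewrite l1norm_orthant. Qed.

End simplices.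

(** * Trajectories *)

Section trajectories.
Context {R : realType} {K : finType}.
Notation mu := (@lebesgue_measure R).
Implicit Types (q : K -> R) (w : R -> K -> R) (a b s : R).

(** A pair of controls acts on the state only through the product control
    [w s = tensor (u s) (v s)], which is itself a control on the simplex of [I * J]. With this [w],
    [state 0 q u v] and [trajectory q w] are convertible, so the results below about a single
    control apply to the game. *)
Definition trajectory q w s : K -> R :=
  fun k => q k + \int[mu]_(r in `[0, s]) w r k.

Definition lipschitz (L : R) (f : (K -> R) -> R) :=
  forall x y, `|f x - f y| <= L * l1norm (x - y).

Definition gen_payoff (f : (K -> R) -> R) (A : K -> R) q w : R :=
  \int[mu]_(s in `[0, 1]) (f (trajectory q w s) + inner (w s) A).

Section one_control.
Variables (q : K -> R) (w : R -> K -> R).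
Hypothesis hw : controls 0 w.

Lemma controlP s : 0 <= s -> s <= 1 -> simplex (w s).
Proof. by move=> s0 s1; apply: hw.2; rewrite in_itv/= s0. Qed.

Lemma control_integrable k : mu.-integrable `[0, 1] (EFin \o (w ^~ k)).
Proof.
apply: (@bounded_itv_integrable _ _ _ 1); first exact: hw.1.
by move=> s; rewrite in_itv/= => /andP[s0 s1]; apply/simplex_norm_le1/controlP.
Qed.

Lemma integrable_co01 (f : R -> R) a b : 0 <= a -> b <= 1 ->
  mu.-integrable `[0, 1] (EFin \o f) -> mu.-integrable `[a, b[ (EFin \o f).
Proof.
move=> a0 b1; apply: integrableS => //.
by move=> x /=; rewrite !in_itv/= => /andP[ax xb]; rewrite (le_trans a0)//= ltW// (lt_le_trans xb).
Qed.

Lemma trajectory_co s k : s <= 1 ->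
  trajectory q w s k = q k + \int[mu]_(r in `[0, s[) w r k.
Proof.
move=> s1; rewrite /trajectory Rintegral_itv_bndo_bndc//.
exact/integrable_co01/control_integrable.
Qed.

Lemma trajectoryB a b k : 0 <= a -> a <= b -> b <= 1 ->
  trajectory q w b k - trajectory q w a k = \int[mu]_(r in `[a, b[) w r k.
Proof.
move=> a0 ab b1; rewrite !trajectory_co ?(le_trans ab)//.
rewrite (Rintegral_itv_split a0 ab); first by ring.
exact/integrable_co01/control_integrable.
Qed.

Lemma trajectory0 : trajectory q w 0 = q.
Proof.
by apply/funext => k; rewrite /trajectory set_itv1 Rintegral_set1 addr0.
Qed.

Lemma trajectory_homo a b k : 0 <= a -> a <= b -> b <= 1 ->
  trajectory q w a k <= trajectory q w b k.
Proof.
move=> a0 ab b1; rewrite -subr_ge0 trajectoryB//; apply: Rintegral_ge0 => s.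
rewrite /= in_itv/= => /andP[sa sb].
by case: (@controlP s) => //; [exact: le_trans sa|rewrite ltW// (lt_le_trans sb)].
Qed.

(** Coordinates never decrease, so the norm of an increment is the sum of its coordinates. This is
    the integral of the total mass of [w s], which is 1: the state moves at unit speed. *)
Lemma l1norm_trajectoryB a b : 0 <= a -> a <= b -> b <= 1 ->
  l1norm (trajectory q w b - trajectory q w a) = b - a.
Proof.
move=> a0 ab b1; rewrite l1norm_orthant; last first.
  by move=> k; rewrite subr_ge0 trajectory_homo.
rewrite (eq_bigr (fun k => \int[mu]_(r in `[a, b[) w r k)); last first.
  by move=> k _; exact: trajectoryB.
rewrite -Rintegral_sum//; last by move=> k; exact/integrable_co01/control_integrable.
rewrite (_ : \int[_]_(_ in _) _ = \int[mu]_(s in `[a, b[) 1); last first.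
  apply: eq_Rintegral => s; rewrite inE/= in_itv/= => /andP[sa sb].
  by case: (@controlP s) => //; [exact: le_trans sa|rewrite ltW// (lt_le_trans sb)].
by rewrite Rintegral_co_cst// mul1r.
Qed.

Lemma l1norm_trajectoryB_sym a b : 0 <= a <= 1 -> 0 <= b <= 1 ->
  l1norm (trajectory q w b - trajectory q w a) = `|b - a|.
Proof.
move=> /andP[a0 a1] /andP[b0 b1]; have [ab|/ltW ba] := leP a b.
  by rewrite l1norm_trajectoryB// ger0_norm// subr_ge0.
by rewrite -l1normN opprB l1norm_trajectoryB// distrC ger0_norm// subr_ge0.
Qed.

Lemma orthant_trajectory s : orthant q -> 0 <= s <= 1 -> orthant (trajectory q w s).
Proof.
move=> q0 /andP[s0 s1] k; apply: le_trans (q0 k) _.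
by rewrite -{1}trajectory0 trajectory_homo.
Qed.

Lemma l1norm_trajectory s : orthant q -> 0 <= s <= 1 ->
  l1norm (trajectory q w s) = l1norm q + s.
Proof.
move=> q0 s01; have /andP[s0 s1] := s01; have := l1norm_trajectoryB (lexx 0) s0 s1.
rewrite trajectory0 subr0 => E; rewrite -[in RHS]E !l1norm_orthant//.
- by rewrite -big_split/=; apply: eq_bigr => k _; rewrite !fctE addrC subrK.
- by move=> k; rewrite subr_ge0 -{1}trajectory0 trajectory_homo.
- exact: orthant_trajectory.
Qed.

(** By unit speed, [f] along the path is [L]-Lipschitz in time, hence measurable and bounded. *)
Lemma lipschitz_trajectory_integrable L f : 0 <= L -> lipschitz L f ->
  mu.-integrable `[0, 1] (EFin \o (fun s => f (trajectory q w s))).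
Proof.
move=> L0 fL; apply: (@bounded_itv_integrable _ _ _ (`|f q| + L)).
  apply: (@lipschitz_measurable_itv _ _ _ L) => r s.
  rewrite !in_itv/= => r01 s01; apply: le_trans (fL _ _) _.
  by rewrite l1norm_trajectoryB_sym.
move=> s; rewrite in_itv/= => s01.
rewrite -[f (trajectory _ _ _)](subrK (f q)) addrC.
apply: le_trans (ler_normD _ _) _; rewrite lerD2l; apply: le_trans (fL _ _) _.
rewrite -{2}trajectory0 l1norm_trajectoryB_sym ?lexx ?ler01//.
by move: s01 => /andP[s0 s1]; rewrite subr0 ger0_norm// ler_piMr.
Qed.

Lemma inner_control_integrable (A : K -> R) :
  mu.-integrable `[0, 1] (EFin \o (fun s => inner (w s) A)).
Proof.
rewrite (_ : _ \o _ = fun s => (\sum_k (EFin \o (fun r => (w r k * A k)%R)) s)%E).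
  apply: integrable_sum => // k _; rewrite (_ : _ \o _ = ((EFin \o w ^~ k) \* cst (A k)%:E)%E)//.
  exact/integrableZr/control_integrable.
by apply/funext => s /=; rewrite sumEFin.
Qed.

Lemma Rintegral_inner_control (A : K -> R) :
  \int[mu]_(s in `[0, 1]) inner (w s) A = inner (trajectory q w 1 - q) A.
Proof.
rewrite Rintegral_sum//; last first.
  move=> k; rewrite (_ : _ \o _ = ((EFin \o w ^~ k) \* cst (A k)%:E)%E)//.
  exact/integrableZr/control_integrable.
apply: eq_bigr => k _; rewrite RintegralZr//; last exact: control_integrable.
by congr (_ * _); rewrite /trajectory !fctE addrAC subrr add0r.
Qed.

Lemma gen_payoffE f A :
  mu.-integrable `[0, 1] (EFin \o (fun s => f (trajectory q w s))) ->
  gen_payoff f A q w =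
    \int[mu]_(s in `[0, 1]) f (trajectory q w s) + inner (trajectory q w 1 - q) A.
Proof.
move=> fi; rewrite /gen_payoff RintegralD//; last exact: inner_control_integrable.
by rewrite Rintegral_inner_control.
Qed.

(** The term in [A] integrates exactly to the displacement paired with [A]. For the other term, the
    path moves by at most [1/N] on a cell, so [f] stays within [L/N] of its value at the left
    endpoint. *)
Lemma lipschitz_payoff_riemann L f A N : 0 <= L -> lipschitz L f -> (0 < N)%N ->
  `|gen_payoff f A q w - (\sum_(k < N) N%:R^-1 * f (trajectory q w (k%:R / N%:R)) +
     inner (trajectory q w 1 - q) A)| <= L / N%:R.
Proof.
move=> L0 fL N0; have fi := lipschitz_trajectory_integrable L0 fL.
rewrite gen_payoffE// opprD addrACA subrr addr0.
have N0' : 0 < N%:R :> R by rewrite ltr0n.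
(* Induction on the number of cells covered: each contributes an error of at most [L/N] times its
   length [1/N]. *)
suff H n : (n <= N)%N ->
  `|\int[mu]_(s in `[0, n%:R / N%:R[) f (trajectory q w s) -
    \sum_(k < n) N%:R^-1 * f (trajectory q w (k%:R / N%:R))| <=
    n%:R * (L / N%:R / N%:R).
  have := H N (leqnn N); rewrite divff ?gt_eqF// => H1.
  rewrite -Rintegral_itv_bndo_bndc//; last exact: integrable_co01.
  by apply: le_trans H1 _; rewrite mulrC divfK// gt_eqF.
elim: n => [_|n IH nN].
  by rewrite mul0r set_itvco0 Rintegral_set0 big_ord0 subrr normr0 mul0r.
have nN' : n.+1%:R / N%:R <= 1 :> R by rewrite ler_pdivrMr// mul1r ler_nat.
have n0 : 0 <= n%:R / N%:R :> R by rewrite divr_ge0.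
have nn1 : n%:R / N%:R <= n.+1%:R / N%:R :> R by rewrite ler_pM2r ?invr_gt0// ler_nat.
have dn : n.+1%:R / N%:R - n%:R / N%:R = N%:R^-1 :> R.
  by rewrite -mulrBl -natrB// subSnn mul1r.
rewrite big_ord_recr/= (Rintegral_itv_split n0 nn1); last exact: integrable_co01.
rewrite opprD addrACA; apply: le_trans (ler_normD _ _) _.
have -> : n.+1%:R * (L / N%:R / N%:R) = n%:R * (L / N%:R / N%:R) + L / N%:R / N%:R.
  by rewrite -natr1 mulrDl mul1r.
apply: lerD; first exact: IH (ltnW nN).
have -> : N%:R^-1 * f (trajectory q w (n%:R / N%:R)) =
   \int[mu]_(s in `[n%:R / N%:R, n.+1%:R / N%:R[) f (trajectory q w (n%:R / N%:R)).
  by rewrite Rintegral_co_cst// dn mulrC.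
rewrite -RintegralB//; [|exact: integrable_co01|exact: integrable_co_cst].
have -> : L / N%:R / N%:R = L / N%:R * (n.+1%:R / N%:R - n%:R / N%:R) by rewrite dn.
apply: Rintegral_co_bound => //.
  rewrite (_ : _ \o _ = ((EFin \o (fun s => f (trajectory q w s))) \-
     (EFin \o cst (f (trajectory q w (n%:R / N%:R)))))%E)//.
  by apply: integrableB => //; [exact: integrable_co01|exact: integrable_co_cst].
move=> s; rewrite in_itv/= => /andP[ns sn]; apply: le_trans (fL _ _) _.
rewrite ler_wpM2l// l1norm_trajectoryB//.
  by rewrite -[leRHS]dn lerD2r ltW.
by rewrite ltW// (lt_le_trans sn).
Qed.

End one_control.

End trajectories.

(** * A Lipschitz truncation of the frequency payoff *)

Section regularization.
Context {R : realType} {K : finType}.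
Notation mu := (@lebesgue_measure R).
Implicit Types (H A q x : K -> R) (w : R -> K -> R) (e : R).

(* The frequency payoff, made globally Lipschitz by freezing the normalization below [e]. *)
Definition truncated_pay H e x : R := inner H x / Num.max (l1norm x) e.

Lemma max_l1norm_gt0 e x : 0 < e -> 0 < Num.max (l1norm x) e.
Proof. by move=> e0; rewrite lt_max e0 orbT. Qed.

Lemma truncated_pay_bound H e x : 0 < e -> `|truncated_pay H e x| <= l1norm H.
Proof.
move=> e0; have m0 := max_l1norm_gt0 x e0.
rewrite normrM normfV (gtr0_norm m0) ler_pdivrMr//.
apply: le_trans (inner_le_l1norm _ _) _; rewrite ler_wpM2l ?l1norm_ge0//.
by rewrite le_max lexx.
Qed.

Lemma truncated_pay_lipschitz H e : 0 < e ->
  lipschitz (2 * l1norm H / e) (truncated_pay H e).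
Proof.
move=> e0 x y; rewrite /truncated_pay.
set a := Num.max (l1norm x) e; set b := Num.max (l1norm y) e.
have a0 : 0 < a := max_l1norm_gt0 x e0; have b0 : 0 < b := max_l1norm_gt0 y e0.
have ab : `|b - a| <= l1norm (x - y).
  have xy : l1norm x <= l1norm y + l1norm (x - y).
    by rewrite -[in leLHS](subrK y x) addrC l1normD.
  have yx : l1norm y <= l1norm x + l1norm (x - y).
    by rewrite -(opprB y x) l1normN -[in leLHS](subrK x y) addrC l1normD.
  rewrite ler_distlC; apply/andP; split.
    rewrite lerBlDr ge_max; apply/andP; split.
      by apply: le_trans yx _; rewrite lerD2r le_max lexx.
    by rewrite ler_wpDr ?l1norm_ge0// le_max lexx orbT.
  rewrite ge_max; apply/andP; split.
    by apply: le_trans xy _; rewrite lerD2r le_max lexx.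
  by rewrite ler_wpDr ?l1norm_ge0// le_max lexx orbT.
(* The change of numerator is separated from the change of denominator. Each part is at most
   [l1norm H / e * l1norm (x - y)], whence the factor 2; the second part uses that [inner H y / b]
   is bounded by [l1norm H]. *)
have -> : inner H x / a - inner H y / b =
    inner H (x - y) / a + inner H y / b * (b - a) / a.
  have -> : inner H (x - y) = inner H x - inner H y.
    by rewrite /inner -sumrB; apply: eq_bigr => k _; rewrite -mulrBr.
  by field; rewrite !gt_eqF.
have Ha : l1norm H * l1norm (x - y) / a <= l1norm H / e * l1norm (x - y).
  rewrite mulrAC ler_wpM2r ?l1norm_ge0// ler_wpM2l ?l1norm_ge0//.
  by rewrite lef_pV2 ?posrE// le_max lexx orbT.
have -> : 2 * l1norm H / e * l1norm (x - y) =
    l1norm H / e * l1norm (x - y) + l1norm H / e * l1norm (x - y) by ring.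
apply: le_trans (ler_normD _ _) _; apply: lerD; apply: le_trans Ha.
  by rewrite normrM normfV (gtr0_norm a0) ler_pM2r ?invr_gt0// inner_le_l1norm.
rewrite normrM normfV (gtr0_norm a0) ler_pM2r ?invr_gt0// normrM.
by apply: ler_pM => //; exact: truncated_pay_bound.
Qed.

End regularization.

(** * Effect of the truncation and of the initial state on payoffs *)

Section payoff_estimates.
Context {R : realType} {I J : finType}.
Notation mu := (@lebesgue_measure R).
Local Notation K := (I * J)%type.
Implicit Types (H A q x : K -> R) (w : R -> K -> R) (e : R).

Lemma hpayE H x : hpay H x = inner H x / l1norm x.
Proof.
rewrite /hpay; case: eqP => [->|_].
  by rewrite /inner big1 ?mul0r// => k _; rewrite mulr0.
by rewrite /inner mulr_suml; apply: eq_bigr => k _; rewrite /= mulrA mulrAC.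
Qed.

Lemma hpay_truncated H e x : e <= l1norm x -> hpay H x = truncated_pay H e x.
Proof. by move=> ex; rewrite hpayE /truncated_pay max_l. Qed.

Lemma hpay_bound H x : `|hpay H x| <= l1norm H.
Proof.
have [x0|x0] := eqVneq (l1norm x) 0.
  by rewrite hpayE x0 invr0 mulr0 normr0 l1norm_ge0.
rewrite (@hpay_truncated _ (l1norm x))// truncated_pay_bound//.
by rewrite lt_neqAle eq_sym x0 l1norm_ge0.
Qed.

Section one_control.
Variables (w : R -> K -> R).
Hypothesis hw : controls 0 w.

(** [hpay H] may be discontinuous at 0, so measurability comes from a pointwise limit of the
    truncations at level [1/(n+1)]. *)
Lemma hpay_trajectory_integrable H q :
  mu.-integrable `[0, 1] (EFin \o (fun s => hpay H (trajectory q w s))).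
Proof.
apply: (@bounded_itv_integrable _ _ _ (l1norm H)); last first.
  by move=> s _; exact: hpay_bound.
apply: (@measurable_fun_cvg _ _ _ _ (fun n s => truncated_pay H n.+1%:R^-1 (trajectory q w s))).
  move=> n; apply/measurable_EFinP; apply: (measurable_int mu).
  apply: (lipschitz_trajectory_integrable q hw _ (@truncated_pay_lipschitz _ _ _ _ _)) => //.
  by rewrite divr_ge0// mulr_ge0// l1norm_ge0.
(* At a fixed state the truncations are eventually constant: at 0 all of them vanish, and elsewhere
   the level ends up below the norm of the state. *)
move=> s _; set x := trajectory q w s; apply: cvg_near_cst.
have [x0|x0] := eqVneq (l1norm x) 0.
  near=> n; rewrite hpayE /truncated_pay (l1norm0_eq0 x0).
  by rewrite /inner big1 ?mul0r// => k _; rewrite mulr0.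
have {}x0 : 0 < l1norm x by rewrite lt_neqAle eq_sym x0 l1norm_ge0.
near=> n; rewrite -hpay_truncated// ltW//.
by near: n; exact: near_infty_natSinv_lt (PosNum x0).
Unshelve. all: by end_near. Qed.

Lemma gen_payoff_bound H A q : `|gen_payoff (hpay H) A q w| <= l1norm H + l1norm A.
Proof.
rewrite gen_payoffE//; last exact: hpay_trajectory_integrable.
apply: le_trans (ler_normD _ _) _; apply: lerD.
  rewrite -Rintegral_itv_bndo_bndc//; last first.
    exact/(integrable_co01 _ _ (hpay_trajectory_integrable _ _)).
  rewrite -[leRHS]mulr1 -[X in _ * X](subr0 1); apply: Rintegral_co_bound => //.
    exact/(integrable_co01 _ _ (hpay_trajectory_integrable _ _)).
  by move=> s _; exact: hpay_bound.
apply: le_trans (inner_le_l1norm _ _) _.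
by rewrite -{2}(trajectory0 q w) l1norm_trajectoryB// subr0 mul1r.
Qed.

(** The norm of the state at time [s] is [l1norm q + s], so the truncation is inactive from time [e]
    on. Before that, the two integrands differ by at most [2 * l1norm H]. *)
Lemma truncation_error H A q e : orthant q -> 0 < e -> e <= 1 ->
  `|gen_payoff (hpay H) A q w - gen_payoff (truncated_pay H e) A q w| <= 2 * l1norm H * e.
Proof.
move=> q0 e0 e1.
have ih := hpay_trajectory_integrable H q.
have it : mu.-integrable `[0, 1] (EFin \o (fun s => truncated_pay H e (trajectory q w s))).
  apply: (lipschitz_trajectory_integrable q hw _ (@truncated_pay_lipschitz _ _ _ _ e0)) => //.
  by rewrite divr_ge0 ?(ltW e0)// mulr_ge0// l1norm_ge0.
rewrite !gen_payoffE// opprD addrACA subrr addr0.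
rewrite -!Rintegral_itv_bndo_bndc//; try exact: integrable_co01.
rewrite !(Rintegral_itv_split (ltW e0) e1); try exact: integrable_co01.
have -> : \int[mu]_(s in `[e, 1[) hpay H (trajectory q w s) =
          \int[mu]_(s in `[e, 1[) truncated_pay H e (trajectory q w s).
  apply: eq_Rintegral => s; rewrite inE/= in_itv/= => /andP[es s1].
  apply: hpay_truncated; rewrite l1norm_trajectory//.
    by rewrite (le_trans es)// lerDr l1norm_ge0.
  by rewrite (le_trans (ltW e0) es) ltW.
rewrite opprD addrACA subrr addr0 -RintegralB//; try exact: integrable_co01.
rewrite -[X in _ * X](subr0 e); apply: Rintegral_co_bound; first exact: ltW.
  rewrite (_ : _ \o _ = ((EFin \o (fun s => hpay H (trajectory q w s))) \-
     (EFin \o (fun s => truncated_pay H e (trajectory q w s))))%E)//.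
  by apply: integrableB => //; exact: integrable_co01.
move=> s _; rewrite [2 * _]mulr_natl mulr2n; apply: le_trans (ler_normB _ _) _.
by apply: lerD; [exact: hpay_bound|exact: truncated_pay_bound].
Qed.

(** Under the same control the two paths differ by the constant [q - q'], and the terms in [A],
    which see only displacements, cancel. *)
Lemma lipschitz_payoff_init L f A q q' : 0 <= L -> lipschitz L f ->
  `|gen_payoff f A q w - gen_payoff f A q' w| <= L * l1norm (q - q').
Proof.
move=> L0 fL; have fi p := lipschitz_trajectory_integrable p hw L0 fL.
have E s : trajectory q w s - trajectory q' w s = q - q'.
  by apply/funext => k; rewrite !fctE /trajectory; ring.
rewrite !gen_payoffE//.
have -> : trajectory q w 1 - q = trajectory q' w 1 - q'.
  rewrite -[trajectory q w 1](subrK (trajectory q' w 1)) E.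
  by apply/funext => k; rewrite !fctE; ring.
rewrite opprD addrACA subrr addr0.
rewrite -!Rintegral_itv_bndo_bndc//; try exact: (integrable_co01 _ _ (fi _)).
rewrite -RintegralB//; try exact: (integrable_co01 _ _ (fi _)).
rewrite -[leRHS]mulr1 -[X in _ * X](subr0 1); apply: Rintegral_co_bound => //.
  rewrite (_ : _ \o _ = ((EFin \o (fun s => f (trajectory q w s))) \-
     (EFin \o (fun s => f (trajectory q' w s))))%E)//.
  by apply: integrableB => //; exact: (integrable_co01 _ _ (fi _)).
by move=> s _; apply: le_trans (fL _ _) _; rewrite E.
Qed.

End one_control.
End payoff_estimates.

(** * Approximate saddle points of bilinear forms *)

Section approximate_saddle.
Context {R : realType} {I J : finType}.
Variable p : I * J -> R.
Implicit Types (u : I -> R) (v : J -> R).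

Let row i v : R := \sum_j p (i, j) * v j.
Let col u j : R := \sum_i p (i, j) * u i.

Let inner_row u v : inner p (tensor u v) = \sum_i u i * row i v.
Proof.
rewrite /inner (eq_bigr (fun ij => p (ij.1, ij.2) * (u ij.1 * v ij.2))); last by move=> [].
rewrite -(pair_bigA _ (fun i j => p (i, j) * (u i * v j)))/=.
apply: eq_bigr => i _; rewrite mulr_sumr; apply: eq_bigr => j _.
by rewrite mulrCA.
Qed.

Let inner_col u v : inner p (tensor u v) = \sum_j v j * col u j.
Proof.
rewrite inner_row /row; under eq_bigr do rewrite mulr_sumr.
rewrite exchange_big/=; apply: eq_bigr => j _; rewrite mulr_sumr.
by apply: eq_bigr => i _; ring.
Qed.

Let pos (x : R) := Num.max x 0.

(** One-step growth of Blackwell's potential, the sum of squared positive regrets. *)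
Let pos_sq_add (a b : R) : pos (a + b) ^+ 2 <= pos a ^+ 2 + 2 * pos a * b + b ^+ 2.
Proof.
rewrite /pos; case: (leP (a + b) 0) => ab; case: (leP a 0) => a0; by nra.
Qed.

Let row_bound i v : simplex v -> `|row i v| <= l1norm p.
Proof.
move=> hv; apply: le_trans (ler_norm_sum _ _ _) _.
rewrite /l1norm (eq_bigr (fun ij => `|p (ij.1, ij.2)|)); last by move=> [].
rewrite -(pair_bigA _ (fun i j => `|p (i, j)|))/= (bigD1 i)//= ler_wpDr ?sumr_ge0//.
  by move=> i' _; rewrite sumr_ge0.
apply: ler_sum => j _.
by rewrite normrM ler_piMr// simplex_norm_le1.
Qed.

(* Regret matching: player 1 mixes proportionally to positive regrets, player 2 replies
   optimally; [U] and [V] are the cumulated strategies, [r] bounds the regrets. *)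
Lemma regret_matching (hI : (0 < #|I|)%N) (hJ : (0 < #|J|)%N) (T : nat) :
  exists (U : I -> R) (V : J -> R) (r : I -> R),
    [/\ (forall i, 0 <= U i) /\ \sum_i U i = T%:R,
        (forall j, 0 <= V j) /\ \sum_j V j = T%:R,
        forall i j, col U j - row i V <= r i
      & \sum_i Num.max (r i) 0 ^+ 2 <= T%:R * (#|I|%:R * (2 * l1norm p) ^+ 2)].
Proof.
elim: T => [|T [U [V [r [[U0 U1] [V0 V1] UV rT]]]]].
  exists (fun=> 0), (fun=> 0), (fun=> 0); split.
  - by split=> //; rewrite big1.
  - by split=> //; rewrite big1.
  - by move=> i j; rewrite /col /row !big1 ?subrr// => k _; rewrite mulr0.
  - by rewrite mul0r big1// => i _; rewrite maxxx expr0n.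
(* Blackwell's condition: with weights proportional to the positive regrets, the first-order term of
   the potential vanishes against every reply. If no regret is positive, any [u] will do. Player 1
   minimizes here: his regret for row [i] is the excess of what was paid over what [i] would have
   paid. *)
have [u hu ur] : exists2 u, simplex u & forall v,
    \sum_i pos (r i) * (inner p (tensor u v) - row i v) = 0.
  have [S0|S0] := eqVneq (\sum_i pos (r i)) 0.
    have [u hu] := @simplex_nonempty R _ hI; exists u => // v.
    have pr i : pos (r i) = 0.
      move: S0 => /eqP; rewrite psumr_eq0; last by move=> k _; rewrite le_max lexx orbT.
      by move=> /allP/(_ i)/(_ (mem_index_enum _))/eqP.
    by apply: big1 => i _; rewrite pr mul0r.
  have Sge : 0 <= \sum_i pos (r i) by apply: sumr_ge0 => i _; rewrite le_max lexx orbT.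
  exists (fun i => pos (r i) / \sum_k pos (r k)).
    split; first by move=> i; rewrite divr_ge0// le_max lexx orbT.
    by rewrite -mulr_suml divff.
  move=> v; under eq_bigr do rewrite mulrBr.
  rewrite sumrB -mulr_suml inner_row mulr_sumr -sumrB big1// => i _.
  by field.
(* Player 2 maximizes with a pure best reply, so the stage payoff dominates every [col u j]; this
   preserves the bound on [col U j - row i V]. *)
have [j0 hj0] : exists j0, forall j, col u j <= col u j0.
  have [j1 _] := card_gt0P hJ.
  exists [arg max_(j > j1) col u j]%O.
  by case: arg_maxP => // j _ hj j'; exact: hj.
pose v : J -> R := fun j => (j == j0)%:R.
have hv : simplex v.
  split; first by move=> j; exact: ler0n.
  by rewrite (bigD1 j0)//= /v eqxx big1 ?addr0// => j /negPf ->.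
have Buv : inner p (tensor u v) = col u j0.
  rewrite inner_col (bigD1 j0)//= /v eqxx mul1r big1 ?addr0// => j /negPf ->.
  by rewrite mul0r.
exists (fun i => U i + u i), (fun j => V j + v j),
  (fun i => r i + (inner p (tensor u v) - row i v)); split.
- split; first by move=> i; rewrite addr_ge0//; case: hu.
  by rewrite big_split/= U1 -natr1; case: hu => _ ->.
- split; first by move=> j; rewrite addr_ge0//; case: hv.
  by rewrite big_split/= V1 -natr1; case: hv => _ ->.
- move=> i j; have -> : col (fun i => U i + u i) j = col U j + col u j.
    by rewrite /col -big_split/=; apply: eq_bigr => k _; rewrite mulrDr.
  have -> : row i (fun j => V j + v j) = row i V + row i v.
    by rewrite /row -big_split/=; apply: eq_bigr => k _; rewrite mulrDr.
  by rewrite Buv opprD addrACA lerD// lerD2r.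
apply: (@le_trans _ _ (\sum_i (pos (r i) ^+ 2 +
    2 * (pos (r i) * (inner p (tensor u v) - row i v)) + (2 * l1norm p) ^+ 2))).
  apply: ler_sum => i _; apply: le_trans (pos_sq_add _ _) _.
  rewrite mulrA lerD2l -(real_normK (num_real _)) lerXn2r ?nnegrE//.
    by rewrite mulr_ge0// l1norm_ge0.
  apply: le_trans (ler_normB _ _) _; rewrite [2 * _]mulr_natl mulr2n lerD ?row_bound//.
  by apply: le_trans (inner_le_l1norm _ _) _; rewrite (simplex_l1norm (tensor_simplex hu hv)) mulr1.
rewrite !big_split/= -mulr_sumr ur mulr0 addr0 sumr_const -[_ *+ _]mulr_natl.
rewrite [leRHS](_ : _ = T%:R * (#|I|%:R * (2 * l1norm p) ^+ 2) + #|I|%:R * (2 * l1norm p) ^+ 2).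
  by apply: lerD.
by rewrite -[T.+1%:R]natr1; ring.
Qed.

(** The time averages [U / T] and [V / T] work: every regret is at most the square root of [T * C],
    hence at most [T * e] once [T] reaches [C / e ^+ 2]. Averaging over rows and columns passes from
    pure to mixed strategies. *)
Lemma approximate_saddle (hI : (0 < #|I|)%N) (hJ : (0 < #|J|)%N) (e : R) : 0 < e ->
  exists (u0 : I -> R) (v0 : J -> R), [/\ simplex u0, simplex v0
    & forall u v, simplex u -> simplex v ->
        inner p (tensor u0 v) <= inner p (tensor u v0) + e].
Proof.
move=> e0; pose C : R := #|I|%:R * (2 * l1norm p) ^+ 2.
have C0 : 0 <= C by rewrite mulr_ge0// exprn_ge0// mulr_ge0// l1norm_ge0.
pose T := (Num.truncn (C / e ^+ 2)).+1.
have CT : C <= T%:R * e ^+ 2.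
  by rewrite -ler_pdivrMr ?exprn_gt0// ltW// truncnS_gt.
have T0 : 0 < T%:R :> R by rewrite ltr0n.
have [U [V [r [[U0 U1] [V0 V1] UV rT]]]] := regret_matching hI hJ T.
have rTe i : r i <= T%:R * e.
  have : pos (r i) ^+ 2 <= (T%:R * e) ^+ 2.
    apply: (@le_trans _ _ (T%:R * C)).
      apply: le_trans rT; rewrite (bigD1 i)//= lerDl sumr_ge0// => k _.
      exact: sqr_ge0.
    by rewrite exprMn expr2 -mulrA ler_wpM2l.
  rewrite ler_sqr ?nnegrE ?mulr_ge0 ?(ltW e0)//; last by rewrite le_max lexx orbT.
  by apply: le_trans; rewrite le_max lexx.
have colE j : col (fun i => U i / T%:R) j = col U j / T%:R.
  by rewrite /col mulr_suml; apply: eq_bigr => i _; rewrite mulrA.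
have rowE i : row i (fun j => V j / T%:R) = row i V / T%:R.
  by rewrite /row mulr_suml; apply: eq_bigr => j _; rewrite mulrA.
exists (fun i => U i / T%:R), (fun j => V j / T%:R); split.
- by split; [move=> i; exact: divr_ge0|rewrite -mulr_suml U1 divff ?gt_eqF].
- by split; [move=> j; exact: divr_ge0|rewrite -mulr_suml V1 divff ?gt_eqF].
move=> u v [u0 u1] [v0 v1]; rewrite inner_col inner_row.
have H i j : col (fun i => U i / T%:R) j <= row i (fun j => V j / T%:R) + e.
  rewrite colE rowE ler_pdivrMr// mulrDl divfK ?gt_eqF// -lerBlDl mulrC.
  exact: le_trans (UV i j) (rTe i).
have H' i : \sum_j v j * col (fun i => U i / T%:R) j <= row i (fun j => V j / T%:R) + e.
  rewrite -[leRHS]mul1r -[X in X * (_ + e)]v1 mulr_suml; apply: ler_sum => j _.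
  by rewrite ler_wpM2l.
rewrite -[leLHS]mul1r -[X in _ + X]mul1r -[X in X * _]u1 -[X in _ + X * e]u1.
rewrite !mulr_suml -big_split/=.
by apply: ler_sum => i _; rewrite -mulrDr ler_wpM2l.
Qed.

End approximate_saddle.

(** * The discretized game *)

Section discrete_game.
Context {R : realType} {I J : finType}.
Hypotheses (hI : (0 < #|I|)%N) (hJ : (0 < #|J|)%N).
Local Notation K := (I * J)%type.
Variables (f : (K -> R) -> R) (A : K -> R) (d : R).
Implicit Types (x y q : K -> R) (u : I -> R) (v : J -> R) (c : R).

Definition euler_step x u v : K -> R := fun k => x k + d * tensor u v k.

(* Player 1 can secure [c] when the discretized game with [n] remaining steps of length [d]
   starts from [y] and player 2 announces his move first. *)
Fixpoint secures (n : nat) y c : Prop :=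
  if n is m.+1 then
    forall v, simplex v -> exists2 u, simplex u & secures m (euler_step y u v) (c - d * f y)
  else c <= inner y A.

Definition euler_path (x : nat -> K -> R) (u : nat -> I -> R) (v : nat -> J -> R) N :=
  forall k, (k < N)%N -> x k.+1 = euler_step (x k) (u k) (v k).

(** Choice makes the answers of player 1 a total function; where nothing is secured it returns an
    arbitrary mixed action, so that its values always lie in the simplex. *)
Lemma secures_response : exists resp : nat -> (K -> R) -> R -> (J -> R) -> (I -> R),
  forall n y c v, simplex (resp n y c v) /\
    (simplex v -> secures n.+1 y c ->
     secures n (euler_step y (resp n y c v) v) (c - d * f y)).
Proof.
suff H (a : nat * (K -> R) * R * (J -> R)) : exists u, simplex u /\
    (simplex a.2 -> secures a.1.1.1.+1 a.1.1.2 a.1.2 ->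
     secures a.1.1.1 (euler_step a.1.1.2 u a.2) (a.1.2 - d * f a.1.1.2)).
  have [g hg] := choice H.
  by exists (fun n y c v => g (n, y, c, v)) => n y c v; exact: (hg (n, y, c, v)).
case: a => [[[n y] c] v] /=.
have [[hv hs]|hn] := pselect (simplex v /\ secures n.+1 y c).
  by have [u hu hw] := hs v hv; exists u.
have [u hu] := @simplex_nonempty R _ hI; exists u; split=> // hv hs.
by exfalso; exact: hn.
Qed.

(** Negating the quantifiers in [secures]: an unsecured level leaves player 2 a move after which it
    stays unsecured whatever the answer. *)
Lemma not_secures_move : exists move : nat -> (K -> R) -> R -> (J -> R),
  forall n y c, simplex (move n y c) /\
    (~ secures n.+1 y c -> forall u, simplex u ->
     ~ secures n (euler_step y u (move n y c)) (c - d * f y)).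
Proof.
suff H (a : nat * (K -> R) * R) : exists v, simplex v /\
    (~ secures a.1.1.+1 a.1.2 a.2 -> forall u, simplex u ->
     ~ secures a.1.1 (euler_step a.1.2 u v) (a.2 - d * f a.1.2)).
  have [g hg] := choice H.
  by exists (fun n y c => g (n, y, c)) => n y c; exact: (hg (n, y, c)).
case: a => [[n y] c] /=.
have [hs|hn] := pselect (secures n.+1 y c).
  by have [v hv] := @simplex_nonempty R _ hJ; exists v.
have : exists v, ~ (simplex v -> exists2 u, simplex u &
    secures n (euler_step y u v) (c - d * f y)) by exact/existsNP.
move=> [v /not_implyP[hv hv']]; exists v; split=> // _ u hu hs.
by apply: hv'; exists u.
Qed.

Lemma not_secures_strategy N q c : ~ secures N q c ->
  exists sigma : seq (I -> R) -> J -> R, (forall h, simplex (sigma h)) /\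
    forall (u : nat -> I -> R) (x : nat -> K -> R),
      (forall k, (k < N)%N -> simplex (u k)) -> x 0%N = q ->
      euler_path x u (fun k => sigma (mkseq u k)) N ->
      \sum_(k < N) d * f (x k) + inner (x N) A <= c.
Proof.
have [move hmove] := not_secures_move.
move=> hN.
(* The memory, recomputed from the past moves of player 1, holds the number of remaining steps, the
   position and the level still to be prevented. [move n] serves a game with [n.+1] steps left,
   hence the predecessor. *)
pose act (m : nat * (K -> R) * R) := move m.1.1.-1 m.1.2 m.2.
pose upd (m : nat * (K -> R) * R) u :=
  (m.1.1.-1, euler_step m.1.2 u (act m), m.2 - d * f m.1.2).
pose mem h := foldl upd (N, q, c) h.
exists (act \o mem); split; first by move=> h; exact: (hmove _ _ _).1.
move=> u x hu x0 hx.
have memS k : mem (mkseq u k.+1) = upd (mem (mkseq u k)) (u k).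
  by rewrite mkseqS /mem foldl_rcons.
(* Invariant: the remaining level is unsecured, and together with the payoff already collected it
   adds up to [c]. *)
have H k : (k <= N)%N -> [/\ (mem (mkseq u k)).1.1 = (N - k)%N,
    (mem (mkseq u k)).1.2 = x k,
    ~ secures (N - k) (x k) (mem (mkseq u k)).2 &
    (mem (mkseq u k)).2 + \sum_(j < k) d * f (x j) = c].
  elim: k => [_|k IH kN].
    by rewrite subn0 /= x0 big_ord0 addr0.
  have [E1 E2 E3 E4] := IH (ltnW kN); rewrite memS /=.
  have ES : (N - k = (N - k.+1).+1)%N by rewrite subnSK.
  split.
  - by rewrite E1 ES.
  - by rewrite E2 hx.
  - rewrite hx// E2; move: E3; rewrite ES => E3.
    have := (hmove (N - k.+1)%N (x k) (mem (mkseq u k)).2).2 E3 (u k) (hu k kN).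
    by rewrite /act /= E1 E2 ES.
  - by rewrite big_ord_recr/= E2 -E4; ring.
have [_ _ E3 E4] := H N (leqnn N).
move: E3; rewrite subnn/= => /negP; rewrite -ltNge => E3.
by rewrite -E4 addrC lerD2r ltW.
Qed.

Let sq x : R := \sum_k x k ^+ 2.

(** Expanding the square, the cross term is [2 * d] times a gap that the saddle inequality bounds by
    [d]. The quadratic term compares two vectors with entries in the unit interval. *)
Let sq_step x y u v u' v' : 0 <= d -> simplex u -> simplex v -> simplex u' -> simplex v' ->
  inner (x - y) (tensor u v) <= inner (x - y) (tensor u' v') + d ->
  sq (euler_step x u v - euler_step y u' v') <= sq (x - y) + d ^+ 2 * (2 + #|{: K}|%:R).
Proof.
move=> d0 hu hv hu' hv' hs.
have [t0 _] := tensor_simplex hu hv; have [t0' _] := tensor_simplex hu' hv'.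
have t1 k := @simplex_le1 _ _ _ k (tensor_simplex hu hv).
have t1' k := @simplex_le1 _ _ _ k (tensor_simplex hu' hv').
have -> : sq (euler_step x u v - euler_step y u' v') = sq (x - y) +
    2 * d * (inner (x - y) (tensor u v) - inner (x - y) (tensor u' v')) +
    d ^+ 2 * sq (tensor u v - tensor u' v').
  rewrite /inner -sumrB !mulr_sumr -!big_split/=; apply: eq_bigr => k _.
  by rewrite /euler_step !fctE; ring.
have s1 : sq (tensor u v - tensor u' v') <= #|{: K}|%:R.
  rewrite -sum1_card natr_sum; apply: ler_sum => k _; rewrite !fctE.
  have := t0 k; have := t0' k; have := t1 k; have := t1' k.
  move: (tensor u v k) (tensor u' v' k) => a b; nra.
rewrite -addrA lerD2l (_ : _ * (2 + _) = 2 * d * d + d ^+ 2 * #|{: K}|%:R); last by ring.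
apply: lerD; last by rewrite ler_wpM2l// sqr_ge0.
by rewrite ler_wpM2l ?mulr_ge0// lerBlDl.
Qed.

Let l1norm_sq x r : 0 <= r -> sq x <= r ^+ 2 -> l1norm x <= #|{: K}|%:R * r.
Proof.
move=> r0 xr; rewrite mulr_natl -sumr_const; apply: ler_sum => k _.
rewrite -(@ler_pXn2r _ 2)// ?nnegrE// real_normK ?num_real//.
by apply: le_trans xr; rewrite /sq (bigD1 k)//= lerDl sumr_ge0// => k' _; exact: sqr_ge0.
Qed.

(* Extremal aiming: a fictitious path [y], on which player 1 answers player 2, is kept close to
   the real path [x] by playing, on both, an approximate saddle point of the form [x - y]. *)
Lemma secures_strategy N q c L r : 0 < d -> d * N%:R = 1 -> 0 <= L -> lipschitz L f ->
  0 <= r -> d * (2 + #|{: K}|%:R) <= r ^+ 2 -> secures N q c ->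
  exists sigma : seq (J -> R) -> I -> R, (forall h, simplex (sigma h)) /\
    forall (v : nat -> J -> R) (x : nat -> K -> R),
      (forall k, (k < N)%N -> simplex (v k)) -> x 0%N = q ->
      euler_path x (fun k => sigma (mkseq v k)) v N ->
      c <= \sum_(k < N) d * f (x k) + inner (x N) A + (L + l1norm A) * (#|{: K}|%:R * r).
Proof.
move=> d0 dN L0 fL r0 dr hN.
have [resp hresp] := secures_response.
have [sad hsad] : exists sad : (K -> R) -> (I -> R) * (J -> R), forall p,
    [/\ simplex (sad p).1, simplex (sad p).2 & forall u v, simplex u -> simplex v ->
      inner p (tensor (sad p).1 v) <= inner p (tensor u (sad p).2) + d].
  suff H p : exists uv : (I -> R) * (J -> R), [/\ simplex uv.1, simplex uv.2 &
      forall u v, simplex u -> simplex v ->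
      inner p (tensor uv.1 v) <= inner p (tensor u uv.2) + d].
    by have [g hg] := choice H; exists g; exact: hg.
  by have [u0 [v0 H]] := approximate_saddle p hI hJ d0; exists (u0, v0).
(* The memory holds the remaining steps, the fictitious position [y], the real position [x] and the
   level still secured along [y]. One half of the saddle point of [x - y] is played for real
   ([act]); the other is the fictitious move of player 2 ([opp]), which [ans] answers so as to keep
   the level secured. *)
pose act (m : nat * (K -> R) * (K -> R) * R) := (sad (m.1.2 - m.1.1.2)).1.
pose opp (m : nat * (K -> R) * (K -> R) * R) := (sad (m.1.2 - m.1.1.2)).2.
pose ans (m : nat * (K -> R) * (K -> R) * R) := resp m.1.1.1.-1 m.1.1.2 m.2 (opp m).
pose upd (m : nat * (K -> R) * (K -> R) * R) v :=
  (m.1.1.1.-1, euler_step m.1.1.2 (ans m) (opp m), euler_step m.1.2 (act m) v,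
   m.2 - d * f m.1.1.2).
pose mem h := foldl upd (N, q, q, c) h.
have hact m : simplex (act m) by case: (hsad (m.1.2 - m.1.1.2)).
have hopp m : simplex (opp m) by case: (hsad (m.1.2 - m.1.1.2)).
have hans m : simplex (ans m) by case: (hresp m.1.1.1.-1 m.1.1.2 m.2 (opp m)).
exists (act \o mem); split => [h|v x hv x0 hx]; first exact: hact.
have memS k : mem (mkseq v k.+1) = upd (mem (mkseq v k)) (v k).
  by rewrite mkseqS /mem foldl_rcons.
pose y k := (mem (mkseq v k)).1.1.2; pose b k := (mem (mkseq v k)).2.
pose C : R := 2 + #|{: K}|%:R.
have C0 : 0 <= C by rewrite addr_ge0.
pose rho : R := #|{: K}|%:R * r.
(* Since [d * N = 1], the accumulated growth is at most [d * C], hence at most [r ^+ 2]. *)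
have close k : (k <= N)%N -> sq (x k - y k) <= k%:R * (d ^+ 2 * C) ->
    l1norm (x k - y k) <= rho.
  move=> kN h; apply: l1norm_sq => //; apply: le_trans h _.
  apply: le_trans dr; rewrite -/C.
  have -> : d * C = N%:R * (d ^+ 2 * C) by rewrite -[LHS]mul1r -[X in X * _]dN; ring.
  by rewrite ler_wpM2r ?ler_nat// mulr_ge0// sqr_ge0.
(* The level decreases by the running payoff at [y]; replacing [y] by [x] costs at most
   [d * (L * rho)] per step. *)
have H k : (k <= N)%N -> [/\ (mem (mkseq v k)).1.1.1 = (N - k)%N,
    (mem (mkseq v k)).1.2 = x k,
    secures (N - k) (y k) (b k),
    sq (x k - y k) <= k%:R * (d ^+ 2 * C) &
    c <= b k + \sum_(j < k) d * f (x j) + k%:R * (d * (L * rho))].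
  elim: k => [_|k IH kN].
    rewrite subn0 /= x0 big_ord0 !addr0 !mul0r addr0; split => //.
    by rewrite /y/= /sq big1// => i _; rewrite !fctE subrr expr0n.
  have [E1 E2 E3 E4 E5] := IH (ltnW kN).
  have ES : (N - k = (N - k.+1).+1)%N by rewrite subnSK.
  have xS : x k.+1 = euler_step (x k) (act (mem (mkseq v k))) (v k) by rewrite hx.
  have yS : y k.+1 = euler_step (y k) (ans (mem (mkseq v k))) (opp (mem (mkseq v k))).
    by rewrite /y memS.
  have bS : b k.+1 = b k - d * f (y k) by rewrite /b memS.
  split.
  - by rewrite memS /= E1 ES.
  - by rewrite memS /= E2 xS.
  - rewrite yS bS; move: E3; rewrite ES => E3.
    by have := (hresp _ _ _ (opp (mem (mkseq v k)))).2 (hopp _) E3; rewrite /ans E1 ES.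
  - rewrite xS yS -[k.+1%:R]natr1 mulrDl mul1r.
    apply: le_trans (sq_step (ltW d0) (hact _) (hv k kN) (hans _) (hopp _) _) _.
      rewrite -E2; have [_ _ H] := hsad ((mem (mkseq v k)).1.2 - y k).
      by apply: H; [exact: hans|exact: hv].
    by rewrite lerD2r.
  - rewrite bS big_ord_recr/= -[k.+1%:R]natr1 mulrDl mul1r.
    apply: le_trans E5 _.
    have : d * f (y k) <= d * f (x k) + d * (L * rho).
      rewrite -mulrDr ler_pM2l// -lerBlDl.
      apply: le_trans (ler_norm _) _; apply: le_trans (fL _ _) _.
      rewrite ler_wpM2l// -(opprB (x k)) l1normN; exact: close (ltnW kN) E4.
    lra.
have [_ _ E3 E4 E5] := H N (leqnn N).
move: E3; rewrite subnn/= => E3.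
have E6 : inner (y N) A <= inner (x N) A + l1norm A * rho.
  rewrite -lerBlDl -innerBl; apply: le_trans (ler_norm _) _.
  apply: le_trans (inner_le_l1norm _ _) _; rewrite mulrC ler_wpM2l ?l1norm_ge0//.
  by rewrite -(opprB (x N)) l1normN; exact: close E4.
have E7 : N%:R * (d * (L * rho)) = L * rho by rewrite mulrA [_ * d]mulrC dN mul1r.
rewrite -/rho mulrDl; move: E5; rewrite E7; lra.
Qed.

End discrete_game.

(** * Delayed strategies *)

Section delayed_strategies.
Context {R : realType}.
Notation mu := (@lebesgue_measure R).

(** The answer before [(k+1)/N] depends only on the opponent before [k/N]. For [k = 0] the premise
    is void: the first step is played blindly. *)
Definition delayed (N : nat) (K L : finType) (a : (R -> L -> R) -> (R -> K -> R)) :=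
  set_fun (controls 0) (controls 0) a /\
  forall v1 v2, controls 0 v1 -> controls 0 v2 -> forall k,
    (forall s, 0 <= s <= 1 -> s < k%:R / N%:R -> v1 s = v2 s) ->
    forall s, 0 <= s <= 1 -> s < k.+1%:R / N%:R -> a v1 s = a v2 s.

Lemma delayed_nonanticipative (N : nat) (K L : finType) (a : (R -> L -> R) -> (R -> K -> R)) :
  (0 < N)%N -> delayed N a -> nonanticipative 0 a.
Proof.
move=> N0 [af ad]; split => // v1 v2 h1 h2 t; rewrite in_itv/= => /andP[t0 t1] v12 s.
rewrite in_itv/= => /andP[s0 st].
have N0' : 0 < N%:R :> R by rewrite ltr0n.
have sN : 0 <= s * N%:R by rewrite mulr_ge0.
apply: (ad _ _ h1 h2 (Num.truncn (s * N%:R))).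
- move=> r /andP[r0 _] rk; apply: v12; rewrite in_itv/= r0/=.
  apply: le_trans (ltW rk) _; apply: le_trans st.
  by rewrite ler_pdivrMr// truncn_le.
- by rewrite s0 (le_trans st).
- by rewrite ltr_pdivlMr// truncnS_gt.
Qed.

(* Against a delayed strategy the play is built one time step after another. *)
Lemma delayed_response (N : nat) (K L : finType) (hK : (0 < #|K|)%N)
    (a : (R -> L -> R) -> (R -> K -> R)) (b : (R -> K -> R) -> (R -> L -> R)) :
  (0 < N)%N -> delayed N a -> nonanticipative 0 b ->
  exists2 u, controls 0 u & {in `[0, 1], a (b u) =1 u}.
Proof.
move=> N0 [af ad] [bf bn]; have [p hp] := @simplex_nonempty R _ hK.
have N0' : 0 < N%:R :> R by rewrite ltr0n.
(* Iterating [a \o b] from an arbitrary constant control fixes one more cell each time: [U n] and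
   [U n.+1] agree before [n/N]. Index [N.+1] is needed to cover the endpoint 1. *)
pose U n := iter n (a \o b) (fun=> p).
have hU n : controls 0 (U n).
  elim: n => [|n IH]; last exact: af (bf _ IH).
  by split=> [k|s _//]; exact: measurable_cst.
have UE n s : 0 <= s <= 1 -> s < n%:R / N%:R -> U n s = U n.+1 s.
  elim: n s => [|n IH] s s01 sn.
    by move: s01; rewrite mul0r in sn; case/andP => /le_lt_trans/(_ sn); rewrite ltxx.
  apply: (ad _ _ (bf _ (hU n)) (bf _ (hU n.+1)) n) => // r r01 rn.
  (* Agreement is known on a half-open interval, while [nonanticipative] asks for a closed one with
     positive right end; [r'] lies in between. *)
  have [r' [r'0 r'1 rr' r'n]] : exists r', [/\ 0 < r', r' <= 1, r <= r' & r' < n%:R / N%:R].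
    case/andP: r01 => r0 r1; have [h|h] := ltP (1 : R) (n%:R / N%:R); first by exists 1.
    by exists ((r + n%:R / N%:R) / 2); split; lra.
  apply: (bn _ _ (hU n) (hU n.+1) r' _ _ r _); rewrite ?in_itv/= ?r'0 ?r'1//.
    move=> x; rewrite in_itv/= => /andP[x0 xr]; apply: IH.
      by rewrite x0 (le_trans xr).
    exact: le_lt_trans r'n.
  by case/andP: r01 => ->.
exists (U N.+1) => // s; rewrite in_itv/= => s01; apply/esym/(UE N.+1) => //.
rewrite ltr_pdivlMr//; case/andP: s01 => _ s1.
by rewrite (@le_lt_trans _ _ N%:R)// ?ltr_nat// ler_piMl.
Qed.

Definition average N (K : finType) (v : R -> K -> R) (k : nat) : K -> R :=
  fun l => N%:R * \int[mu]_(s in `[k%:R / N%:R, k.+1%:R / N%:R[) v s l.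

(** In cell [k] the discrete strategy is fed the averages of the opponent over cells [0] to [k-1].
    While one control is constant on a cell, the average of the other determines the increment of
    the state. *)
Definition sampled N (K L : finType) (sigma : seq (L -> R) -> K -> R)
    (v : R -> L -> R) : R -> K -> R :=
  fun s => sigma (mkseq (average N v) (Num.truncn (s * N%:R))).

Section grid.
Variable N : nat.
Hypothesis N0 : (0 < N)%N.

Let N0' : 0 < N%:R :> R. Proof. by rewrite ltr0n. Qed.

Let grid_ge0 k : 0 <= k%:R / N%:R :> R. Proof. by rewrite divr_ge0. Qed.

Let gridS k : k%:R / N%:R <= k.+1%:R / N%:R :> R.
Proof. by rewrite ler_pM2r ?invr_gt0// ler_nat. Qed.

Let grid_le1 k : (k < N)%N -> k.+1%:R / N%:R <= 1 :> R.
Proof. by move=> kN; rewrite ler_pdivrMr// mul1r ler_nat. Qed.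

Let grid_step k : k.+1%:R / N%:R - k%:R / N%:R = N%:R^-1 :> R.
Proof. by rewrite -mulrBl -natrB// subSnn mul1r. Qed.

Lemma average_simplex (K : finType) (v : R -> K -> R) k :
  controls 0 v -> (k < N)%N -> simplex (average N v k).
Proof.
move=> hv kN; have vs s : s \in `[k%:R / N%:R, k.+1%:R / N%:R[ -> simplex (v s).
  rewrite in_itv/= => /andP[s0 s1]; apply: (controlP hv); first exact: le_trans s0.
  by rewrite ltW// (lt_le_trans s1)// grid_le1.
split.
  move=> l; apply: mulr_ge0 => //; apply: Rintegral_ge0 => s hs.
  by case: (vs s) => //.
rewrite -mulr_sumr -Rintegral_sum//; last first.
  by move=> l; apply: integrable_co01 (control_integrable hv l) => //; exact: grid_le1.
rewrite (_ : \int[_]_(_ in _) _ = \int[mu]_(s in `[k%:R / N%:R, k.+1%:R / N%:R[) 1); last first.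
  by apply: eq_Rintegral => s; rewrite inE/= => hs; case: (vs s).
by rewrite Rintegral_co_cst// mul1r grid_step divff// gt_eqF.
Qed.

Lemma sampled_control (K L : finType) (sigma : seq (L -> R) -> K -> R) v :
  (forall h, simplex (sigma h)) -> controls 0 (sampled N sigma v).
Proof.
move=> hs; split=> [k|s _]; last exact: hs.
pose F n := sigma (mkseq (average N v) n) k.
(* A step function, written with [N.+1] cells because time 1 falls into cell [N]. *)
apply: (@eq_measurable_fun _ _ _ _ _ (fun s => \sum_(n < N.+1)
   F n * \1_(`[(n : nat)%:R / N%:R, n.+1%:R / N%:R[%classic : set R) s)); last first.
  apply: measurable_sum => n; apply: measurable_funM; first exact: measurable_cst.
  exact: measurable_indic.
move=> s; rewrite inE/= in_itv/= => /andP[s0 s1].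
have sN : 0 <= s * N%:R by rewrite mulr_ge0.
have tN : (Num.truncn (s * N%:R) < N.+1)%N.
  by rewrite ltnS truncn_le_nat -natr1 ltr_pwDr// ler_piMl.
rewrite (bigD1 (Ordinal tN))//= indicE mem_set/=; last first.
  by rewrite in_itv/= ler_pdivrMr// ltr_pdivlMr// truncn_itv.
rewrite mulr1 big1 ?addr0// => n nt; rewrite indicE memNset ?mulr0//=.
rewrite in_itv/= ler_pdivrMr// ltr_pdivlMr// => h; move/eqP: nt; apply.
by apply/val_inj => /=; rewrite (truncn_def h).
Qed.

Lemma sampled_delayed (K L : finType) (sigma : seq (L -> R) -> K -> R) :
  (forall h, simplex (sigma h)) -> delayed N (sampled N sigma).
Proof.
move=> hs; split; first by move=> v _; exact: sampled_control.
move=> v1 v2 _ _ k v12 s /andP[s0 s1] sk; rewrite /sampled; congr sigma.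
have sN : 0 <= s * N%:R by rewrite mulr_ge0.
have tk : (Num.truncn (s * N%:R) <= k)%N by rewrite truncn_le_nat -ltr_pdivlMr.
(* This bound keeps the averaged cells inside the unit interval, the only place where [v1] and [v2]
   are assumed to agree. *)
have tN : (Num.truncn (s * N%:R) <= N)%N.
  by rewrite truncn_le_nat -natr1 ltr_pwDr// ler_piMl.
apply/eq_in_map => j; rewrite mem_iota add0n => /andP[_ jt].
apply/funext => l; congr (_ * _); apply: eq_Rintegral => r; rewrite inE/= in_itv/= => /andP[jr rj].
have r0 : 0 <= r by exact: le_trans jr.
rewrite v12// ?r0/=.
  by rewrite ltW// (lt_le_trans rj)// grid_le1// (leq_trans jt).
by rewrite (lt_le_trans rj)// ler_pM2r ?invr_gt0// ler_nat (leq_trans jt).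
Qed.

Lemma sampled_grid (K L : finType) (sigma : seq (L -> R) -> K -> R) v k s :
  s \in `[k%:R / N%:R, k.+1%:R / N%:R[ -> sampled N sigma v s = sigma (mkseq (average N v) k).
Proof.
rewrite in_itv/= ler_pdivrMr// ltr_pdivlMr// => h.
by rewrite /sampled (truncn_def h).
Qed.

Lemma tensor_control (I J : finType) (u : R -> I -> R) (v : R -> J -> R) :
  controls 0 u -> controls 0 v -> controls 0 (fun s => tensor (u s) (v s)).
Proof.
move=> hu hv; split=> [ij|s s01].
  by apply: measurable_funM; [exact: hu.1|exact: hv.1].
by apply: tensor_simplex; [exact: hu.2|exact: hv.2].
Qed.

(** The velocity is bilinear, so the Euler step is exact when [u] is frozen and [v] is replaced by
    its average. *)
Lemma state_step_l (I J : finType) q (u : R -> I -> R) (v : R -> J -> R) p k :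
  controls 0 u -> controls 0 v -> (k < N)%N ->
  {in `[k%:R / N%:R, k.+1%:R / N%:R[, forall s, u s = p} ->
  state 0 q u v (k.+1%:R / N%:R) =
    euler_step N%:R^-1 (state 0 q u v (k%:R / N%:R)) p (average N v k).
Proof.
move=> hu hv kN up; have hw := tensor_control hu hv; apply/funext => -[i j].
apply/eqP; rewrite /euler_step addrC -subr_eq; apply/eqP.
rewrite (trajectoryB q hw)// ?grid_le1//.
rewrite (_ : \int[_]_(_ in _) _ =
    \int[mu]_(s in `[k%:R / N%:R, k.+1%:R / N%:R[) (p i * v s j)); last first.
  by apply: eq_Rintegral => s; rewrite inE => hs; rewrite /tensor/= up.
rewrite RintegralZl//; last first.
  by apply: integrable_co01 (control_integrable hv j) => //; exact: grid_le1.
by rewrite /tensor/= /average [p i * (_ * _)]mulrCA mulKf// gt_eqF.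
Qed.

Lemma state_step_r (I J : finType) q (u : R -> I -> R) (v : R -> J -> R) p k :
  controls 0 u -> controls 0 v -> (k < N)%N ->
  {in `[k%:R / N%:R, k.+1%:R / N%:R[, forall s, v s = p} ->
  state 0 q u v (k.+1%:R / N%:R) =
    euler_step N%:R^-1 (state 0 q u v (k%:R / N%:R)) (average N u k) p.
Proof.
move=> hu hv kN vp; have hw := tensor_control hu hv; apply/funext => -[i j].
apply/eqP; rewrite /euler_step addrC -subr_eq; apply/eqP.
rewrite (trajectoryB q hw)// ?grid_le1//.
rewrite (_ : \int[_]_(_ in _) _ =
    \int[mu]_(s in `[k%:R / N%:R, k.+1%:R / N%:R[) (u s i * p j)); last first.
  by apply: eq_Rintegral => s; rewrite inE => hs; rewrite /tensor/= vp.
rewrite RintegralZr//; last first.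
  by apply: integrable_co01 (control_integrable hu i) => //; exact: grid_le1.
by rewrite /tensor/= /average -[_ * _ * p j]mulrA mulKf// gt_eqF.
Qed.

End grid.
End delayed_strategies.

(** * Existence of the value *)

Section values.
Context {R : realType} {I J : finType}.
Hypotheses (hI : (0 < #|I|)%N) (hJ : (0 < #|J|)%N).
Variables A H : I * J -> R.
Implicit Types (q : I * J -> R) (u : R -> I -> R) (v : R -> J -> R) (c e : R).

Lemma eq_payoff q u1 u2 v1 v2 : {in `[0, 1], u1 =1 u2} -> {in `[0, 1], v1 =1 v2} ->
  payoff A H 0 q u1 v1 = payoff A H 0 q u2 v2.
Proof.
move=> u12 v12; apply: eq_Rintegral => s; rewrite inE/= in_itv/= => /andP[s0 s1].
congr (hpay H _ + _); last by rewrite u12 ?v12// in_itv/= s0.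
apply/funext => k; congr (_ + _); apply: eq_Rintegral => r.
rewrite inE/= in_itv/= => /andP[r0 rs].
by rewrite u12 ?v12// in_itv/= r0 (le_trans rs).
Qed.

(** For the lower value, [a] is an admissible strategy. For the upper value, [delayed_response]
    plays [a] against any nonanticipative [b], giving a control [u] for which [b] concedes at least
    [c]. *)
Lemma delayed_lower_bound q N (a : (R -> J -> R) -> (R -> I -> R)) c :
  (0 < N)%N -> delayed N a ->
  (forall v, controls 0 v -> c <= payoff A H 0 q (a v) v) ->
  (c%:E <= lower_value A H 0 q)%E /\ (c%:E <= upper_value A H 0 q)%E.
Proof.
move=> N0 ad ac; split.
  apply: (@le_trans _ _ (ereal_inf [set (payoff A H 0 q (a v) v)%:E | v in controls 0])).
    by apply: le_ereal_inf_tmp => _ [v hv <-]; rewrite lee_fin ac.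
  apply: ereal_sup_ubound; exists a => //; exact: delayed_nonanticipative ad.
apply: le_ereal_inf_tmp => _ [b hb <-].
have [u hu ub] := delayed_response hI N0 ad hb.
apply: (@le_trans _ _ (payoff A H 0 q u (b u))%:E).
  rewrite lee_fin -(@eq_payoff q (a (b u)) u (b u) (b u))//; apply: ac.
  by case: hb => + _; exact.
by apply: ereal_sup_ubound; exists u.
Qed.

Lemma delayed_upper_bound q N (b : (R -> I -> R) -> (R -> J -> R)) c :
  (0 < N)%N -> delayed N b ->
  (forall u, controls 0 u -> payoff A H 0 q u (b u) <= c) ->
  (lower_value A H 0 q <= c%:E)%E /\ (upper_value A H 0 q <= c%:E)%E.
Proof.
move=> N0 bd bc; split; last first.
  apply: (@le_trans _ _ (ereal_sup [set (payoff A H 0 q u (b u))%:E | u in controls 0])).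
    by apply: ereal_inf_lbound; exists b => //; exact: delayed_nonanticipative bd.
  by apply: ge_ereal_sup => _ [u hu <-]; rewrite lee_fin bc.
apply: ge_ereal_sup => _ [a ha <-].
have [v hv va] := delayed_response hJ N0 bd ha.
apply: (@le_trans _ _ (payoff A H 0 q (a v) v)%:E).
  by apply: ereal_inf_lbound; exists v.
rewrite lee_fin -(@eq_payoff q (a v) (a v) (b (a v)) v)//; apply: bc.
by case: ha => + _; exact.
Qed.

Lemma payoff_truncation q u v e : orthant q -> controls 0 u -> controls 0 v ->
  0 < e -> e <= 1 ->
  `|payoff A H 0 q u v -
    gen_payoff (truncated_pay H e) A q (fun s => tensor (u s) (v s))| <= 2 * l1norm H * e.
Proof. by move=> q0 hu hv; exact: (truncation_error (tensor_control hu hv)). Qed.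

Lemma small_multiple (C e : R) : 0 <= C -> 0 < e -> exists2 d : R, 0 < d & d <= 1 /\ C * d <= e.
Proof.
move=> C0 e0; have C1 : 0 < C + 1 by rewrite ltr_pwDr.
exists (Num.min 1 (e / (C + 1))); first by rewrite lt_min ltr01 divr_gt0.
split; first by rewrite ge_min lexx.
apply: (@le_trans _ _ ((C + 1) * (e / (C + 1)))); last by rewrite mulrC divfK// gt_eqF.
apply: ler_pM => //; first by rewrite le_min ler01 divr_ge0// ltW.
  by rewrite lerDl.
by rewrite ge_min lexx orbT.
Qed.

(** Each of truncation, Riemann sum and extremal aiming is allotted an error [e / 3]; the last
    occurs only when player 1 secures the level. *)
Lemma game_determined q c e : orthant q -> 0 < e ->
  [\/ (((c - e)%:E <= lower_value A H 0 q)%E /\ ((c - e)%:E <= upper_value A H 0 q)%E)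
    | ((lower_value A H 0 q <= (c + e)%:E)%E /\ (upper_value A H 0 q <= (c + e)%:E)%E)].
Proof.
move=> q0 e0; have e3 : 0 < e / 3 by rewrite divr_gt0.
have M0 : 0 <= 2 * l1norm H by rewrite mulr_ge0// l1norm_ge0.
have [h h0 [h1 hM]] := small_multiple M0 e3.
pose f := truncated_pay H h; pose L := 2 * l1norm H / h.
have L0 : 0 <= L by rewrite divr_ge0// ltW.
have fL : lipschitz L f := truncated_pay_lipschitz H h0.
have B0 : 0 <= (L + l1norm A) * #|{: I * J}|%:R by rewrite mulr_ge0// addr_ge0// l1norm_ge0.
have [r r0 [_ rB]] := small_multiple B0 e3.
(* The first summand makes [N] large enough for the Riemann error, the second for the aiming radius
   [r]. *)
pose C : R := L / (e / 3) + (2 + #|{: I * J}|%:R) / r ^+ 2.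
have C10 : 0 <= L / (e / 3) by rewrite divr_ge0// ltW.
have C20 : 0 <= (2 + #|{: I * J}|%:R) / r ^+ 2 :> R by rewrite divr_ge0// sqr_ge0.
pose N := (Num.truncn C).+1.
have CN : C < N%:R by exact: truncnS_gt.
have N0 : (0 < N)%N by [].
have N0' : 0 < N%:R :> R by rewrite ltr0n.
have LN : L / N%:R <= e / 3.
  by rewrite ler_pdivrMr// mulrC -ler_pdivrMr// ltW// (le_lt_trans _ CN)// lerDl.
have dr : N%:R^-1 * (2 + #|{: I * J}|%:R) <= r ^+ 2.
  rewrite mulrC ler_pdivrMr// mulrC -ler_pdivrMr ?exprn_gt0//.
  by rewrite ltW// (le_lt_trans _ CN)// lerDr.
have NN : N%:R / N%:R = 1 :> R by rewrite divff// gt_eqF.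
pose S u v := \sum_(k < N) N%:R^-1 * f (state 0 q u v (k%:R / N%:R)) +
  inner (state 0 q u v (N%:R / N%:R)) A.
have SE u v : controls 0 u -> controls 0 v ->
    `|payoff A H 0 q u v - (S u v - inner q A)| <= e / 3 + e / 3.
  move=> hu hv; have hw := tensor_control hu hv.
  apply: le_trans (ler_distD (gen_payoff f A q (fun s => tensor (u s) (v s))) _ _) _.
  apply: lerD; first by apply: le_trans (payoff_truncation q0 hu hv h0 h1) _.
  have := lipschitz_payoff_riemann q hw A L0 fL N0.
  rewrite innerBl /S NN addrA => /le_trans; exact.
(* The discretized game pays [inner (x N) A] at the end, whereas the payoff counts only the
   displacement from [q]; hence the shift by [inner q A]. *)
have [hs|hs] := pselect (secures f A N%:R^-1 N q (c + inner q A)).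
  left; have dN0 : 0 < N%:R^-1 :> R by rewrite invr_gt0.
  have dN : N%:R^-1 * N%:R = 1 :> R by rewrite mulrC.
  have [sigma [hsig hb]] :=
    secures_strategy hI hJ dN0 dN L0 fL (ltW r0) dr hs.
  apply: (@delayed_lower_bound q N (sampled N sigma)) => //; first exact: sampled_delayed.
  move=> v hv; have hu : controls 0 (sampled N sigma v) by exact: sampled_control.
  have : c + inner q A <= S (sampled N sigma v) v + (L + l1norm A) * (#|{: I * J}|%:R * r).
    apply: (hb (average N v) (fun k => state 0 q (sampled N sigma v) v (k%:R / N%:R))).
    - by move=> k; exact: average_simplex.
    - by rewrite mul0r; exact: trajectory0.
    - by move=> k kN; apply: state_step_l => // s; exact: sampled_grid.
  have := SE _ _ hu hv; rewrite ler_distl => /andP[+ _].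
  move: rB; rewrite -mulrA.
  move: (S _ _) (payoff _ _ _ _ _ _) (inner q A) ((L + _) * _) => *; lra.
right; have [sigma [hsig hb]] := not_secures_strategy hJ hs.
apply: (@delayed_upper_bound q N (sampled N sigma)) => //; first exact: sampled_delayed.
move=> u hu; have hv : controls 0 (sampled N sigma u) by exact: sampled_control.
have : S u (sampled N sigma u) <= c + inner q A.
  apply: (hb (average N u) (fun k => state 0 q u (sampled N sigma u) (k%:R / N%:R))).
  - by move=> k; exact: average_simplex.
  - by rewrite mul0r; exact: trajectory0.
  - by move=> k kN; apply: state_step_r => // s; exact: sampled_grid.
have := SE _ _ hu hv; rewrite ler_distl => /andP[_ +].
move: (S _ _) (payoff _ _ _ _ _ _) (inner q A) => *; lra.
Qed.

Lemma payoff_bound q u v : controls 0 u -> controls 0 v ->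
  `|payoff A H 0 q u v| <= l1norm H + l1norm A.
Proof. by move=> hu hv; exact: (gen_payoff_bound (tensor_control hu hv)). Qed.

Lemma constant_delayed (K L : finType) (p : K -> R) :
  simplex p -> delayed 1 (fun _ : R -> L -> R => fun=> p).
Proof. by move=> hp; split => // v _; split=> [k|s _//]; exact: measurable_cst. Qed.

(** Constant strategies show that both values are finite. Were they distinct, their midpoint with a
    quarter of their gap as tolerance would contradict both alternatives of [game_determined]. *)
Lemma game_value_exists q : orthant q -> exists w, is_value A H 0 q w.
Proof.
move=> q0; have [p hp] := @simplex_nonempty R _ hI; have [p' hp'] := @simplex_nonempty R _ hJ.
pose B := l1norm H + l1norm A.
have da := @constant_delayed I J p hp; have db := @constant_delayed J I p' hp'.
have [la ua] : ((- B)%:E <= lower_value A H 0 q)%E /\ ((- B)%:E <= upper_value A H 0 q)%E.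
  apply: (delayed_lower_bound _ da) => // v hv.
  by have := payoff_bound q (da.1 v hv) hv; rewrite ler_norml => /andP[].
have [lb ub] : (lower_value A H 0 q <= B%:E)%E /\ (upper_value A H 0 q <= B%:E)%E.
  apply: (delayed_upper_bound _ db) => // u hu.
  by have := payoff_bound q hu (db.1 u hu); rewrite ler_norml => /andP[].
have [a Ea] : exists a, lower_value A H 0 q = a%:E.
  by move: la lb; case: (lower_value A H 0 q) => // a _ _; exists a.
have [b Eb] : exists b, upper_value A H 0 q = b%:E.
  by move: ua ub; case: (upper_value A H 0 q) => // b _ _; exists b.
exists a; split => //; rewrite Eb; congr (_%:E).
have [ab|ab|//] := ltrgtP a b.
- have e0 : 0 < (b - a) / 4 by lra.
  have [] := game_determined ((a + b) / 2) q0 e0; rewrite Ea Eb !lee_fin; lra.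
- have e0 : 0 < (a - b) / 4 by lra.
  have [] := game_determined ((a + b) / 2) q0 e0; rewrite Ea Eb !lee_fin; lra.
Qed.

(** Controls and strategies do not refer to the initial state, so the same [a] is used from [q] and
    [q']. *)
Lemma lower_value_le q q' e :
  (forall u v, controls 0 u -> controls 0 v ->
     payoff A H 0 q u v <= payoff A H 0 q' u v + e) ->
  (lower_value A H 0 q <= lower_value A H 0 q' + e%:E)%E.
Proof.
move=> he; apply: ge_ereal_sup => _ [a ha <-].
apply: (@le_trans _ _ (ereal_inf [set (payoff A H 0 q' (a v) v)%:E | v in controls 0] + e%:E)%E).
  rewrite -leeBlDr//; apply: le_ereal_inf_tmp => _ [v hv <-].
  rewrite leeBlDr//; apply: (@le_trans _ _ (payoff A H 0 q (a v) v)%:E).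
    by apply: ereal_inf_lbound; exists v.
  by rewrite -EFinD lee_fin; apply: he => //; case: ha => + _; exact.
by rewrite leeD2r//; apply: ereal_sup_ubound; exists a.
Qed.

Lemma value_le q q' w w' e : is_value A H 0 q w -> is_value A H 0 q' w' ->
  (forall u v, controls 0 u -> controls 0 v ->
     payoff A H 0 q u v <= payoff A H 0 q' u v + e) -> w <= w' + e.
Proof. by move=> [Eq _] [Eq' _] /lower_value_le; rewrite Eq Eq' -EFinD lee_fin. Qed.

(** The truncation level [h] is fixed first and costs [e / 3] at each of the two initial states; [d]
    is then chosen from the Lipschitz constant of the truncated payoff. *)
Lemma payoff_near0 e : 0 < e -> exists2 d, 0 < d & forall q u v,
  orthant q -> l1norm q < d -> controls 0 u -> controls 0 v ->
  `|payoff A H 0 q u v - payoff A H 0 0 u v| <= e.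
Proof.
move=> e0; have e3 : 0 < e / 3 by rewrite divr_gt0.
have M0 : 0 <= 2 * l1norm H by rewrite mulr_ge0// l1norm_ge0.
have [h h0 [h1 hM]] := small_multiple M0 e3.
pose f := truncated_pay H h; pose L := 2 * l1norm H / h.
have L0 : 0 <= L by rewrite divr_ge0// ltW.
have fL : lipschitz L f := truncated_pay_lipschitz H h0.
have [d d0 [_ hd]] := small_multiple L0 e3.
exists d => // q u v q0 qd hu hv.
have hw := tensor_control hu hv.
have z0 : orthant (0 : I * J -> R) by move=> k; exact: lexx.
have H1 := payoff_truncation q0 hu hv h0 h1.
have H2 := payoff_truncation z0 hu hv h0 h1.
have H3 := lipschitz_payoff_init hw A q 0 L0 fL.
have H4 : L * l1norm (q - 0) <= e / 3.
  by rewrite subr0; apply: le_trans hd; rewrite ler_wpM2l// ltW.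
move: H1 H2 H3; rewrite !ler_distl => /andP[? ?] /andP[? ?] /andP[? ?].
apply/andP; split; lra.
Qed.

End values.

(** * The l1-norm and the product topology at the origin *)

Section continuity_at_origin.
Context {R : realType} {K : finType}.

Lemma near_l1norm_lt (d : R) : 0 < d -> \forall q \near (0 : K -> R), l1norm q < d.
Proof.
move=> d0; have c0 : 0 < #|K|%:R + 1 :> R by rewrite ltr_wpDl.
have e0 : 0 < d / (#|K|%:R + 1) by rewrite divr_gt0.
have : \forall q \near (0 : K -> R), forall k, `|q k| < d / (#|K|%:R + 1).
  apply: (@filter_forall _ _ (fun k (q : K -> R) => `|q k| < d / (#|K|%:R + 1))
    (nbhs (0 : K -> R))) => k.
  have H : nbhs (0 : K -> R) (proj k @^-1` ball (0 : R) (d / (#|K|%:R + 1))).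
    exact: (@proj_continuous K (fun=> R) k (0 : K -> R) _ (nbhsx_ballx _ _ e0)).
  apply: filterS H => q; rewrite /ball/= sub0r normrN; exact.
apply: filterS => q hq.
apply: (@le_lt_trans _ _ (#|K|%:R * (d / (#|K|%:R + 1)))).
  by rewrite mulr_natl -sumr_const; apply: ler_sum => k _; exact/ltW.
by rewrite mulrA ltr_pdivrMr// mulrC ltr_pM2l// ltrDl.
Qed.

End continuity_at_origin.

Unset Implicit Arguments.

Theorem theorem2p3 (R : realType) (I J : finType)
    (hI : (0 < #|I|)%N) (hJ : (0 < #|J|)%N) (A H : I * J -> R) :
  exists W : (I * J -> R) -> R,
    [/\ forall q : I * J -> R, orthant q -> q != 0 -> is_value A H 0 q (W q),
        is_value A H 0 0 (W 0)
      & W q @[q --> within (@orthant R _) (0 : I * J -> R)^'] --> W 0].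
Proof.
pose W q := fine (lower_value A H 0 q).
have z0 : orthant (0 : I * J -> R) by move=> k; exact: lexx.
have HW q : orthant q -> is_value A H 0 q (W q).
  by move=> /(game_value_exists hI hJ A H)[w [E1 E2]]; rewrite /W E1.
exists W; split; [by move=> q + _; exact: HW|exact: HW|].
apply/cvgrPdist_le => e e0.
have [d d0 hd] := payoff_near0 A H e0.
(* The estimate holds on a full neighbourhood of 0 intersected with the orthant, so the puncture at
   0 is dropped. *)
rewrite near_withinE; apply: cvg_within.
have := near_l1norm_lt (K := (I * J)%type) d0; apply: filterS => q qd q0.
have bound u v : controls 0 u -> controls 0 v ->
  `|payoff A H 0 q u v - payoff A H 0 0 u v| <= e by exact: hd.
rewrite ler_distl; apply/andP; split.
  rewrite lerBlDr; apply: (value_le (HW _ q0) (HW _ z0)) => u v hu hv.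
  by have := bound u v hu hv; rewrite ler_distl => /andP[]; lra.
apply: (value_le (HW _ z0) (HW _ q0)) => u v hu hv.
by have := bound u v hu hv; rewrite ler_distl => /andP[]; lra.
Qed.
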